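(* Let $\mathcal{S}\colon 0\to A\to B\to C\to 0$ be a short exact sequence of pre-admissible chain complexes of $R$-modules which is weakly admissible. Then $$\chi_{\mathrm H}(A)-\chi_{\mathrm H}(B)+\chi_{\mathrm H}(C)=0 .$$
   Context: $R$ is an arbitrary unital commutative Noetherian integral domain with field of fractions $Q$; $\mathbb{N}=\{1,2,3,\dots\}$. The rank of an $R$-module $A$ is $\mathrm{rank}\,A=\dim_Q(A\otimes_R Q)$. Let $M=(m_{i,j})_{i,j\in\mathbb{N}}$ be the Cesàro matrix: $m_{i,j}=1/i$ if $i\ge j$ and $m_{i,j}=0$ otherwise. A real sequence $\mathbf a=(a_n)_{n\in\mathbb{N}}$ is H-convergent if $M^k\mathbf a$ converges for some integer $k>0$; its H-limit $\mathrm{H}\text{-}\lim\mathbf a$ is $\lim M^k\mathbf a$ for sufficiently large $k$ (if $M^k\mathbf a$ converges then $M^m\mathbf a$ converges to the same limit for all $m\ge k$). An H-null sequence is an H-convergent sequence with H-limit $0$. A chain complex $C$ of $R$-modules is pre-admissible if $C_n=0$ for $n<0$, all homology modules $H_nC$ are finitely generated, and the sequence $\mathbf HC=\big((-1)^{n-1}\,\mathrm{rank}\,H_{n-1}C\big)_{n\in\mathbb{N}}$ is H-convergent. Its infinite Euler characteristic is $\chi_{\mathrm H}(C)=\mathrm{H}\text{-}\lim\mathbf HC$. For a short exact sequence $\mathcal{S}\colon 0\to A\to B\to C\to 0$ of pre-admissible chain complexes, let $\delta_n\colon H_nC\to H_{n-1}A$ denote the connecting homomorphisms of the long exact homology sequence.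 $\mathcal{S}$ is weakly admissible if the sequence $\big(\tfrac1n(-1)^{n-1}\,\mathrm{rank}\,\mathrm{im}\,\delta_n\big)_{n\in\mathbb{N}}$ is H-null. *)

(* Defs.v *)
From HB Require Import structures.
From mathcomp Require Import all_boot all_order all_algebra.
From mathcomp.multinomials Require Import freeg.
From mathcomp Require Import boolp classical_sets reals topology normedtype sequences.

Set Implicit Arguments.
Unset Strict Implicit.
Unset Printing Implicit Defensive.

Import Order.TTheory GRing.Theory Num.Theory.
Import numFieldNormedType.Exports.

Local Open Scope ring_scope.
Local Open Scope quotient_scope.
Local Open Scope classical_set_scope.

Section Submodule.
Context (R : pzRingType) (V : lmodType R) (S : submodClosed V).

Record submod := Submod { submod_val : V; submodP : submod_val \in S }.

HB.instance Definition _ := [isSub for submod_val].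
HB.instance Definition _ := [Choice of submod by <:].
HB.instance Definition _ := [SubChoice_isSubLmodule of submod by <:].

(* A copy of [S] on which the closure under opposite is registered: in MathComp
   [submodClosed] is stated for semimodules and does not provide it. *)
Definition submod_pred : {pred V} := fun x => x \in S.

Lemma submod_pred_closed : submod_closed submod_pred.
Proof.
by split=> [|a x y Sx Sy]; [exact: rpred0|apply: rpredD => //; apply: rpredZ].
Qed.

HB.instance Definition _ :=
  GRing.isSubmodClosed.Build R V submod_pred submod_pred_closed.

(* [Quotient.quot] is MathComp's quotient of an additive group by a subgroup;
   scalar multiplication is added to it here. *)
Definition quotmod := Quotient.quot submod_pred.

HB.instance Definition _ := GRing.Zmodule.on quotmod.
HB.instance Definition _ := Quotient.on quotmod.

Definition quotmod_proj (x : V) : quotmod := \pi_quotmod x.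

Lemma quotmod_projP (x y : V) :
  quotmod_proj x = quotmod_proj y <-> x - y \in S.
Proof.
rewrite (Quotient.idealrBE submod_pred x y); split=> [e|/eqP e //].
by apply/eqP.
Qed.

Lemma quotmod_projB : {morph quotmod_proj : x y / x - y}.
Proof. exact: raddfB. Qed.

Lemma quotmod_projD : {morph quotmod_proj : x y / x + y}.
Proof. exact: raddfD. Qed.

Lemma quotmod_surj (h : quotmod) : exists x, quotmod_proj x = h.
Proof. by exists (repr h); rewrite /quotmod_proj reprK. Qed.

Definition quotmod_scale (a : R) (h : quotmod) : quotmod :=
  quotmod_proj (a *: repr h).

Lemma quotmod_projZ (a : R) (x : V) :
  quotmod_proj (a *: x) = quotmod_scale a (quotmod_proj x).
Proof.
apply/quotmod_projP; rewrite -scalerBr; apply: rpredZ.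
by apply/quotmod_projP; rewrite /quotmod_proj reprK.
Qed.

Lemma quotmod_scaleA a b h :
  quotmod_scale a (quotmod_scale b h) = quotmod_scale (a * b) h.
Proof. by case: (quotmod_surj h) => x <-; rewrite -!quotmod_projZ scalerA. Qed.

Lemma quotmod_scale1 : left_id 1 quotmod_scale.
Proof. by move=> h; case: (quotmod_surj h) => x <-; rewrite -quotmod_projZ scale1r. Qed.

Lemma quotmod_scaleDr : right_distributive quotmod_scale +%R.
Proof.
move=> a h h'; case: (quotmod_surj h) => x <-; case: (quotmod_surj h') => y <-.
by rewrite -quotmod_projD -!quotmod_projZ scalerDr quotmod_projD.
Qed.

Lemma quotmod_scaleDl h : {morph quotmod_scale^~ h : a b / a + b}.
Proof.
move=> a b; case: (quotmod_surj h) => x <-.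
by rewrite -!quotmod_projZ scalerDl quotmod_projD.
Qed.

HB.instance Definition _ := GRing.Zmodule_isLmodule.Build R quotmod
  quotmod_scaleA quotmod_scale1 quotmod_scaleDr quotmod_scaleDl.

Lemma quotmod_proj_is_linear : linear quotmod_proj.
Proof. by move=> a x y; rewrite quotmod_projD quotmod_projZ. Qed.

HB.instance Definition _ :=
  GRing.isLinear.Build R V quotmod _ quotmod_proj quotmod_proj_is_linear.

End Submodule.

Section KernelImage.
Context (R : pzRingType) (U V : lmodType R) (f : {linear U -> V}).

Definition ker_pred : {pred U} := fun x => f x == 0.
Definition im_pred : {pred V} := fun y => `[< exists x, f x = y >].

Lemma ker_pred_closed : submod_closed ker_pred.
Proof.
split=> [|a x y]; rewrite !unfold_in ?linear0 // => /eqP fx /eqP fy.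
by rewrite linearP fx fy scaler0 addr0.
Qed.

Lemma im_pred_closed : submod_closed im_pred.
Proof.
split=> [|a x y]; first by apply/asboolP; exists 0; rewrite linear0.
move=> /asboolP[x' <-] /asboolP[y' <-]; apply/asboolP.
by exists (a *: x' + y'); rewrite linearP.
Qed.

HB.instance Definition _ := GRing.isSubmodClosed.Build R U ker_pred ker_pred_closed.
HB.instance Definition _ := GRing.isSubmodClosed.Build R V im_pred im_pred_closed.

End KernelImage.

Definition finitely_generated (R : pzRingType) (V : lmodType R) : Prop :=
  exists (n : nat) (e : 'I_n -> V),
    forall v, exists c : 'I_n -> R, v = \sum_i c i *: e i.

Definition noetherian (R : comPzRingType) : Prop :=
  forall I : set R,
    I 0 -> (forall a x y, I x -> I y -> I (a * x + y)) ->
    exists (n : nat) (e : 'I_n -> R),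
      (forall i, I (e i)) /\
      forall x, I x -> exists c : 'I_n -> R, x = \sum_i c i * e i.

Definition is_basis (K : fieldType) (V : lmodType K) (n : nat) (e : 'I_n -> V) :=
  forall v, exists! c : {ffun 'I_n -> K}, v = \sum_i c i *: e i.

(* Dimension of a finite-dimensional vector space; it is 0 by convention
   on infinite-dimensional ones. *)
Definition vdim (K : fieldType) (V : lmodType K) : nat :=
  xget 0%N [set n | exists e : 'I_n -> V, is_basis e].

Section Zspan.
Context (V : zmodType) (G : set V).

(* The additive subgroup generated by [G]. *)
Definition zspan : {pred V} := fun x =>
  `[< forall P : set V, P 0 -> (forall u v, P u -> P v -> P (u - v)) ->
        G `<=` P -> P x >].

Lemma zspan_closed : zmod_closed zspan.
Proof.
split=> [|x y /asboolP Hx /asboolP Hy]; apply/asboolP => P P0 PB GP //.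
by apply: (PB); [apply: Hx|apply: Hy].
Qed.

HB.instance Definition _ := GRing.isZmodClosed.Build V zspan zspan_closed.

Lemma zspan_gen x : G x -> x \in zspan.
Proof. by move=> Gx; apply/asboolP => P _ _; apply. Qed.

End Zspan.

Lemma freeg_subgroup_ind (T : choiceType) (P : {freeg T / int} -> Prop) :
  P 0 -> (forall u v, P u -> P v -> P (u - v)) -> (forall x, P << x >>) ->
  forall D, P D.
Proof.
move=> P0 PB PU D.
have PN u : P u -> P (- u) by move=> Pu; rewrite -sub0r; apply: PB.
have PD u v : P u -> P v -> P (u + v).
  by move=> Pu Pv; rewrite -[v]opprK; apply: PB => //; apply: PN.
have PMn u n : P u -> P (u *+ n).
  by move=> Pu; elim: n => [|n IH]; rewrite ?mulr0n // mulrS; apply: PD.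
rewrite -(freeg_sumE D); elim/big_ind: _ => // x _.
rewrite -[coeff x D]intz -freegU_mulz.
by case: (coeff x D) => n; rewrite ?NegzE ?mulrNz; [|apply: PN]; apply: PMn.
Qed.

Section TensorFraction.
Context (R : idomainType) (A : lmodType R).
Local Notation Q := {fraction R}.
Local Notation tofrac := (@FracField.tofrac R).
Local Notation F := {freeg (A * Q)%type / int}.

Inductive tensor_rel : set F :=
| tensor_addl a b q :
    tensor_rel (<< (a + b, q) >> - << (a, q) >> - << (b, q) >>)
| tensor_addr a p q :
    tensor_rel (<< (a, p + q) >> - << (a, p) >> - << (a, q) >>)
| tensor_bal r a q :
    tensor_rel (<< (r *: a, q) >> - << (a, tofrac r * q) >>).

(* The tensor product of [A] and [Q] over [R]: the free abelian group on
   [A * Q] modulo the [R]-bilinearity relations. *)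
Definition tensorQ := Quotient.quot (zspan tensor_rel).

HB.instance Definition _ := GRing.Zmodule.on tensorQ.
HB.instance Definition _ := Quotient.on tensorQ.

Definition tensorQ_proj (x : F) : tensorQ := \pi_tensorQ x.

Definition tensor (a : A) (q : Q) : tensorQ := tensorQ_proj << (a, q) >>.

Lemma tensorQ_projP (x y : F) :
  tensorQ_proj x = tensorQ_proj y <-> x - y \in zspan tensor_rel.
Proof.
rewrite (Quotient.idealrBE (zspan tensor_rel) x y); split=> [e|/eqP e //].
by apply/eqP.
Qed.

Lemma tensorQ_projD : {morph tensorQ_proj : x y / x + y}.
Proof. exact: raddfD. Qed.

Lemma tensorQ_surj (h : tensorQ) : exists x, tensorQ_proj x = h.
Proof. by exists (repr h); rewrite /tensorQ_proj reprK. Qed.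

(* The [Q]-module structure is determined by [c *: (a (x) q) = a (x) (c * q)]. *)
Definition free_scale (c : Q) : F -> F :=
  fglift (fun aq : A * Q => << (aq.1, c * aq.2) >> : F).

Lemma free_scaleB c : {morph free_scale c : x y / x - y}.
Proof. exact: lift_is_additive. Qed.

Lemma free_scale0 c : free_scale c 0 = 0.
Proof. by have := free_scaleB c 0 0; rewrite !subrr. Qed.

Lemma free_scaleD c : {morph free_scale c : x y / x + y}.
Proof.
move=> x y; have := free_scaleB c (x + y) y; rewrite addrK => ->.
by rewrite subrK.
Qed.

Lemma free_scaleU c a q : free_scale c << (a, q) >> = << (a, c * q) >>.
Proof. by rewrite /free_scale liftU scale1r. Qed.

Lemma free_scale_zspan c x :
  x \in zspan tensor_rel -> free_scale c x \in zspan tensor_rel.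
Proof.
move=> /asboolP/(_ (fun x => free_scale c x \in zspan tensor_rel)); apply.
- by rewrite free_scale0 rpred0.
- by move=> u v Hu Hv; rewrite free_scaleB rpredB.
move=> _ [a b q|a p q|r a q]; rewrite !free_scaleB !free_scaleU; apply: zspan_gen.
- exact: tensor_addl.
- by rewrite mulrDr; exact: tensor_addr.
- by rewrite mulrCA; exact: tensor_bal.
Qed.

Definition tensorQ_scale (c : Q) (h : tensorQ) : tensorQ :=
  tensorQ_proj (free_scale c (repr h)).

Lemma tensorQ_projZ c x :
  tensorQ_proj (free_scale c x) = tensorQ_scale c (tensorQ_proj x).
Proof.
apply/tensorQ_projP; rewrite -free_scaleB; apply: free_scale_zspan.
by apply/tensorQ_projP; rewrite /tensorQ_proj reprK.
Qed.

Lemma tensorQ_scaleA a b h :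
  tensorQ_scale a (tensorQ_scale b h) = tensorQ_scale (a * b) h.
Proof.
case: (tensorQ_surj h) => x <-; rewrite -!tensorQ_projZ; congr tensorQ_proj.
elim/freeg_subgroup_ind: x => [|u v Hu Hv|[x q]].
- by rewrite !free_scale0.
- by rewrite !free_scaleB Hu Hv.
- by rewrite !free_scaleU mulrA.
Qed.

Lemma tensorQ_scale1 : left_id 1 tensorQ_scale.
Proof.
move=> h; case: (tensorQ_surj h) => x <-; rewrite -tensorQ_projZ.
congr tensorQ_proj; elim/freeg_subgroup_ind: x => [|u v Hu Hv|[x q]].
- by rewrite !free_scale0.
- by rewrite !free_scaleB Hu Hv.
- by rewrite !free_scaleU mul1r.
Qed.

Lemma tensorQ_scaleDr : right_distributive tensorQ_scale +%R.
Proof.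
move=> a h h'; case: (tensorQ_surj h) => x <-; case: (tensorQ_surj h') => y <-.
by rewrite -tensorQ_projD -!tensorQ_projZ free_scaleD tensorQ_projD.
Qed.

Lemma tensorQ_scaleDl h : {morph tensorQ_scale^~ h : a b / a + b}.
Proof.
move=> a b; case: (tensorQ_surj h) => x <-.
rewrite -!tensorQ_projZ -tensorQ_projD; apply/tensorQ_projP.
elim/freeg_subgroup_ind: x => [|u v Hu Hv|[x q]].
- by rewrite !free_scale0 addr0 subr0 rpred0.
- rewrite !free_scaleB.
  have -> : forall p p' q q' r r' : F,
      p - p' - (q - q' + (r - r')) = (p - (q + r)) - (p' - (q' + r')).
    move=> p p' q q' r r'; rewrite (addrACA q) -(opprD q') !opprB.
    by rewrite addrACA [RHS]addrACA [- p' - _]addrC.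
  exact: rpredB.
- rewrite !free_scaleU mulrDl opprD addrA; apply: zspan_gen.
  exact: tensor_addr.
Qed.

HB.instance Definition _ := GRing.Zmodule_isLmodule.Build Q tensorQ
  tensorQ_scaleA tensorQ_scale1 tensorQ_scaleDr tensorQ_scaleDl.

Lemma tensorZ c a q : c *: tensor a q = tensor a (c * q).
Proof. by rewrite /tensor -free_scaleU tensorQ_projZ. Qed.

Definition rank : nat := vdim tensorQ.

End TensorFraction.

(* [diff i j] is the differential [d_i] when [i = j + 1] and zero otherwise;
   carrying both degrees avoids casts between [C n] and [C (n - 1 + 1)]. *)
Record chain_complex (R : pzRingType) := ChainComplex {
  obj :> int -> lmodType R;
  diff : forall i j, {linear obj i -> obj j};
  diff_shape : forall i j x, i <> j + 1 -> diff i j x = 0;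
  diff_diff : forall i j k x, diff j k (diff i j x) = 0
}.

Arguments diff {R} c i j.

Section Homology.
Context (R : pzRingType) (C : chain_complex R) (n : int).

Definition cycles : lmodType R := submod (ker_pred (diff C n (n - 1))).

Definition boundary_pred : {pred cycles} :=
  fun z => val z \in im_pred (diff C (n + 1) n).

Lemma boundary_pred_closed : submod_closed boundary_pred.
Proof.
have E z : (z \in boundary_pred) = (val z \in im_pred (diff C (n + 1) n)) by [].
split=> [|a x y]; rewrite !E ?linear0 ?rpred0 // => Hx Hy.
by rewrite linearP rpredD ?rpredZ.
Qed.

HB.instance Definition _ :=
  GRing.isSubmodClosed.Build R cycles boundary_pred boundary_pred_closed.

Definition homology : lmodType R := quotmod boundary_pred.

Definition homology_class : cycles -> homology :=
  @quotmod_proj _ _ boundary_pred.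

Lemma boundary_diff i (x : C i) (z : cycles) :
  diff C i n x = val z -> z \in boundary_pred.
Proof.
move=> dx; apply/asboolP; have [ei|ni] := eqVneq i (n + 1).
  by case: _ / ei in x dx *; exists x.
by exists 0; rewrite linear0 -dx diff_shape //; apply/eqP.
Qed.

End Homology.

Arguments boundary_pred {R} C n.

Record chain_map (R : pzRingType) (A B : chain_complex R) := ChainMap {
  chain_fun :> forall n, {linear A n -> B n};
  chain_comm : forall i j x,
    chain_fun j (diff A i j x) = diff B i j (chain_fun i x)
}.

Record short_exact (R : pzRingType) (A B C : chain_complex R) := ShortExact {
  ses_in : chain_map A B;
  ses_out : chain_map B C;
  ses_inj : forall n, injective (ses_in n);
  ses_exact : forall n b, ses_out n b = 0 <-> exists a, ses_in n a = b;
  ses_surj : forall n c, exists b, ses_out n b = c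
}.

Section Connecting.
Context (R : pzRingType) (A B C : chain_complex R) (S : short_exact A B C).
Context (n : int).
Local Notation f := (ses_in S).
Local Notation g := (ses_out S).


Definition connecting_rel (z : cycles C n) (y : cycles A (n - 1)) : Prop :=
  exists b : B n, g n b = val z /\ f (n - 1) (val y) = diff B n (n - 1) b.

Lemma connecting_rel_ex z : exists y, connecting_rel z y.
Proof.
have [b gb] := ses_surj S (val z).
have /(ses_exact S)[a fa] : g (n - 1) (diff B n (n - 1) b) = 0.
  by rewrite chain_comm gb; apply/eqP; exact: (submodP z).
have aK : a \in ker_pred (diff A (n - 1) (n - 1 - 1)).
  rewrite unfold_in; apply/eqP; apply: (@ses_inj _ _ _ _ S).
  by rewrite chain_comm fa diff_diff linear0.
by exists (Submod aK), b.
Qed.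

Lemma connecting_relP a z z' y y' : connecting_rel z y -> connecting_rel z' y' ->
  connecting_rel (a *: z + z') (a *: y + y').
Proof.
move=> [b [gb fy]] [b' [gb' fy']]; exists (a *: b + b').
by rewrite !linearP gb gb' fy fy'.
Qed.

Lemma connecting_rel_boundary z y : connecting_rel z y ->
  z \in boundary_pred C n -> y \in boundary_pred A (n - 1).
Proof.
move=> [b [gb fy]] /asboolP[c dc]; have [b' gb'] := ses_surj S c.
have /(ses_exact S)[a fa] : g n (b - diff B (n + 1) n b') = 0.
  by rewrite linearB chain_comm gb' dc gb subrr.
apply: (@boundary_diff _ _ _ n a); apply: (@ses_inj _ _ _ _ S).
by rewrite chain_comm fa linearB diff_diff subr0 -fy.
Qed.

Definition connecting_fun (h : homology C n) : homology A (n - 1) :=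
  homology_class (projT1 (cid (connecting_rel_ex (repr h)))).

(* Independence of the choices made in the definition. *)
Lemma connecting_funE z y : connecting_rel z y ->
  connecting_fun (homology_class z) = homology_class y.
Proof.
move=> zy; rewrite /connecting_fun; case: cid => y' zy' /=.
apply/quotmod_projP; apply: connecting_rel_boundary.
  have := connecting_relP (-1) zy zy'; rewrite !scaleN1r ![- _ + _]addrC; exact.
apply/quotmod_projP; rewrite /quotmod_proj reprK //.
Qed.

Lemma connecting_is_linear : linear connecting_fun.
Proof.
move=> a h h'; have [z <-] := quotmod_surj h; have [z' <-] := quotmod_surj h'.
have [y zy] := connecting_rel_ex z; have [y' zy'] := connecting_rel_ex z'.
rewrite -[LHS]/(connecting_fun (a *: homology_class z + homology_class z')).
rewrite (connecting_funE zy) (connecting_funE zy') -!linearP.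
by apply: connecting_funE; apply: connecting_relP.
Qed.

HB.instance Definition _ := GRing.isLinear.Build R (homology C n)
  (homology A (n - 1)) _ connecting_fun connecting_is_linear.

Definition connecting : {linear homology C n -> homology A (n - 1)} :=
  connecting_fun.

End Connecting.

Section HolderConvergence.
Context {K : realType}.
Implicit Types (a : K ^nat) (l : K).

(* Sequences indexed by [1, 2, 3, ...] are shifted to start at [0]: the term of
   index [i] here is the one of index [i.+1] there. *)
Definition cesaro_coef (i j : nat) : K :=
  if (j <= i)%N then i.+1%:R^-1 else 0.

(* Row [i] of the Cesaro matrix vanishes beyond column [i]. *)
Definition cesaro_mul a : K ^nat :=
  fun i => \sum_(j < i.+1) cesaro_coef i j * a j.

Definition Hconvergent a : Prop :=
  exists2 k, (0 < k)%N & cvgn (iter k cesaro_mul a).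

Definition Hlim a : K :=
  xget 0 [set l | \forall k \near \oo, iter k cesaro_mul a @ \oo --> l].

Definition Hnull a : Prop := Hconvergent a /\ Hlim a = 0.

End HolderConvergence.

Section Euler.
Context (K : realType) (R : idomainType).

Definition homology_rank_seq (C : chain_complex R) : K ^nat :=
  fun n => (-1) ^+ n * (rank (homology C n%:Z))%:R.

Definition pre_admissible (C : chain_complex R) : Prop :=
  [/\ forall (n : int) (x : C n), n < 0 -> x = 0,
      forall n : int, finitely_generated (homology C n)
    & Hconvergent (homology_rank_seq C)].

Definition Euler_char (C : chain_complex R) : K := Hlim (homology_rank_seq C).

Definition weakly_admissible (A B C : chain_complex R) (S : short_exact A B C) :=
  Hnull (fun n => n.+1%:R^-1 * (-1) ^+ n *
    (rank (submod (im_pred (connecting S n.+1%:Z))))%:R : K).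

End Euler.

(* Main.v *)
(* Localizing at the nonzero elements of [R] is exact, so rank is additive on
   exact sequences; concretely, the rank of a finitely generated module is the
   length of any maximal linearly independent family, and such families on the
   image and on the kernel of a map combine into one on its source.  With
   [r n = rank (im delta_n)], the long exact homology sequence gives
   [rank H_n A - rank H_n B + rank H_n C = r n + r n.+1].  The alternating sum
   over [0 <= k <= n] telescopes to [(-1) ^ n * r n.+1], since [delta_0 = 0].
   Hence the Cesaro mean of [HA - HB + HC] is exactly the sequence that weak
   admissibility requires to be H-null, and a Cesaro mean has the same H-limit
   as the original sequence. *)
Require Import Defs.
From HB Require Import structures.
From mathcomp Require Import all_boot all_order all_algebra.
From mathcomp.multinomials Require Import freeg.
From mathcomp Require Import boolp classical_sets functions reals topology normedtype sequences.

Set Implicit Arguments.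
Unset Strict Implicit.
Unset Printing Implicit Defensive.

Import Order.TTheory GRing.Theory Num.Theory.
Import numFieldNormedType.Exports.

Local Open Scope ring_scope.
Local Open Scope quotient_scope.
Local Open Scope classical_set_scope.

Local Notation tofrac := (@FracField.tofrac _).

(** * Clearing denominators in the field of fractions *)

Lemma tofrac_num (R : idomainType) (q : {fraction R}) :
  exists2 d : R, d != 0 & exists r, tofrac d * q = tofrac r.
Proof.
elim/quotW: q => x; exists \d_x; first exact: denom_ratioP.
exists \n_x; unlock FracField.tofrac; rewrite -[LHS]FracField.pi_mul.
apply/eqmodP; rewrite /= FracField.equivfE /FracField.mulf /=.
by rewrite !numden_Ratio ?(oner_neq0, mul1r, mulr1) // denom_ratioP.
Qed.

Lemma common_denominator (R : idomainType) n (q : 'I_n -> {fraction R}) :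
  exists2 d : R, d != 0 & exists r : 'I_n -> R,
    forall i, tofrac d * q i = tofrac (r i).
Proof.
have /choice[d dP] i : exists d : R, d != 0 /\ exists r, tofrac d * q i = tofrac r.
  by have [d d0 dr] := tofrac_num (q i); exists d.
exists (\prod_i d i); first by apply/prodf_neq0 => i _; case: (dP i).
suff /choice[r rP] : forall i, exists r, tofrac (\prod_i d i) * q i = tofrac r.
  by exists r.
move=> i; have [_ [r er]] := dP i; exists (r * \prod_(j | j != i) d j).
by rewrite (bigD1 i) //= rmorphM /= mulrAC er -rmorphM.
Qed.

(** * Tensoring with the field of fractions: denominators and torsion *)

Section TensorTorsion.
Context (R : idomainType) (A : lmodType R).
Local Notation Q := {fraction R}.
Local Notation F := {freeg (A * Q)%type / int}.

(* The numerator of [q] over the denominator [d]; junk when [d * q] is not in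
   [R]. *)
Definition clear (d : R) (q : Q) : R := xget 0 [set r | tofrac r = tofrac d * q].

Lemma clearE d q r : tofrac d * q = tofrac r -> clear d q = r.
Proof.
move=> dq; apply: xget_unique => //= r' er'; apply/eqP.
by rewrite -tofrac_eq er' dq.
Qed.

(* This map does not respect [tensor_rel] for a fixed [d], but it kills any given
   element of the relation subgroup once [d] is divisible enough; this detects
   nonzero tensors without constructing the localization of [A]. *)
Definition clear_eval (d : R) : F -> A :=
  fglift (fun aq : A * Q => clear d aq.2 *: aq.1 : ssrint.zmodule A).

Lemma clear_evalB d x y : clear_eval d (x - y) = clear_eval d x - clear_eval d y.
Proof. exact: (@lift_is_additive _ _ (ssrint.zmodule A)). Qed.

Lemma clear_evalU d a q : clear_eval d << (a, q) >> = clear d q *: a.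
Proof. by rewrite /clear_eval liftU scale1r. Qed.

Lemma clear_eval0 d : clear_eval d 0 = 0.
Proof. by have := clear_evalB d 0 0; rewrite !subrr. Qed.

(** Asking for all multiples of [d] lets the values found for two elements combine into their
    product, which gives closure under subtraction. *)
Lemma clear_eval_zspan (x : F) : x \in zspan (@tensor_rel R A) ->
  exists2 d, d != 0 & forall e, clear_eval (e * d) x = 0.
Proof.
move=> /asboolP/(_ (fun x =>
  exists2 d, d != 0 & forall e, clear_eval (e * d) x = 0)); apply.
- by exists 1; [exact: oner_neq0|move=> e; rewrite clear_eval0].
- move=> u v [d d0 du] [d' d'0 dv]; exists (d * d'); first by rewrite mulf_neq0.
  by move=> e; rewrite clear_evalB mulrA dv mulrAC du subrr.
move=> _ [a b q|a p q|r a q].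
(* A junk value of [clear] is harmless here: the same scalar multiplies all three terms. *)
- exists 1; [exact: oner_neq0|move=> e].
  by rewrite !clear_evalB !clear_evalU scalerDr addrAC addrK subrr.
- have [d d0 [p' ep]] := tofrac_num p; have [d' d'0 [q' eq]] := tofrac_num q.
  exists (d * d'); [by rewrite mulf_neq0|move=> e].
  have Ep : tofrac (e * (d * d')) * p = tofrac (e * d' * p').
    by rewrite !rmorphM /= -ep; rewrite !mulrA [_ * tofrac d']mulrAC.
  have Eq : tofrac (e * (d * d')) * q = tofrac (e * d * q').
    by rewrite !rmorphM /= -eq !mulrA.
  rewrite !clear_evalB !clear_evalU (clearE Ep) (clearE Eq).
  rewrite (@clearE _ _ (e * d' * p' + e * d * q')).
    by rewrite scalerDl addrAC addrK subrr.
  by rewrite mulrDr Ep Eq rmorphD.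
- have [d d0 [q' eq]] := tofrac_num q; exists d => // e.
  have Eq : tofrac (e * d) * q = tofrac (e * q').
    by rewrite !rmorphM /= -eq mulrA.
  rewrite !clear_evalB !clear_evalU (clearE Eq) (@clearE _ _ (r * (e * q'))).
    by rewrite scalerA mulrC subrr.
  by rewrite mulrCA Eq -rmorphM.
Qed.

Lemma tensorDl q : {morph (fun a : A => tensor a q) : a b / a + b}.
Proof.
move=> a b; rewrite /tensor -tensorQ_projD; apply/tensorQ_projP.
by rewrite opprD addrA; apply: zspan_gen; exact: tensor_addl.
Qed.

Lemma tensorZl r (a : A) q : tensor (r *: a) q = tensor a (tofrac r * q).
Proof. by apply/tensorQ_projP; apply: zspan_gen; exact: tensor_bal. Qed.

Lemma tensor0l q : tensor (0 : A) q = 0.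
Proof. by apply: (addrI (tensor 0 q)); rewrite -tensorDl !addr0. Qed.

Lemma tensor_sum n (c : 'I_n -> R) (e : 'I_n -> A) q :
  tensor (\sum_i c i *: e i) q = \sum_i tofrac (c i) *: tensor (e i) q.
Proof.
rewrite (big_morph _ (tensorDl q) (tensor0l q)).
by apply: eq_bigr => i _; rewrite tensorZl tensorZ.
Qed.

(** Evaluating at a [d] that kills the relation gives [d *: a], since [clear d 1 = d]. *)
Lemma tensor1_eq0 (a : A) : tensor a 1 = 0 -> exists2 d : R, d != 0 & d *: a = 0.
Proof.
move=> a0; have /tensorQ_projP : tensorQ_proj << (a, 1) >> = tensorQ_proj 0.
  by rewrite -/(tensor a 1) a0; apply/esym/(raddf0 (\pi_(tensorQ A))).
rewrite subr0 => /clear_eval_zspan[d d0 /(_ 1)].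
by rewrite mul1r clear_evalU (@clearE _ _ d) ?mulr1 //; exists d.
Qed.

(** This makes [tensorQ A] behave as the localization of [A]; a difference is put over the product
    of the two denominators. *)
Lemma tensorQ_frac (h : tensorQ A) :
  exists2 d : R, d != 0 & exists a : A, tofrac d *: h = tensor a 1.
Proof.
have [x <-] := tensorQ_surj h; elim/freeg_subgroup_ind: x => [|u v Hu Hv|[a q]].
- exists 1; first exact: oner_neq0.
  exists 0; rewrite tensor0l (_ : tensorQ_proj 0 = 0) ?scaler0 //.
  exact: (raddf0 (\pi_(tensorQ A))).
- have [d d0 [a ea]] := Hu; have [d' d'0 [b eb]] := Hv.
  exists (d * d'); first by rewrite mulf_neq0.
  exists (d' *: a - d *: b); rewrite (_ : tensorQ_proj (u - v) =
    tensorQ_proj u - tensorQ_proj v); last exact: (raddfB (\pi_(tensorQ A))).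
  have tN (c : A) : tensor (- c) 1 = - tensor c 1.
    by apply/eqP; rewrite -addr_eq0 -tensorDl addNr tensor0l.
  rewrite tensorDl tN !tensorZl -!tensorZ -ea -eb scalerBr !scalerA -!rmorphM.
  by rewrite [d' * d]mulrC.
- have [d d0 [r er]] := tofrac_num q; exists d => //; exists (r *: a).
  by rewrite -/(tensor a q) tensorZ er tensorZl mulr1.
Qed.

End TensorTorsion.

(** * Independence over the ring and dimension over its fractions *)

Section Independence.
Context (R : idomainType).
Implicit Types A : lmodType R.

Definition lin_indep A n (e : 'I_n -> A) : Prop :=
  forall c : 'I_n -> R, \sum_i c i *: e i = 0 -> forall i, c i = 0.

(** Maximality is put as a torsion condition modulo the span of [e], which becomes spanning once
    nonzero scalars are inverted. *)
Definition max_indep A n (e : 'I_n -> A) : Prop :=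
  lin_indep e /\ forall a, exists2 d : R, d != 0 &
    exists c : 'I_n -> R, d *: a = \sum_i c i *: e i.

(** Once the denominators of [q] are cleared, the combination in [A] is only known to be torsion;
    the scalar that kills it moves into the coefficients and cancels in the domain. *)
Lemma lin_indep_tensor A n (e : 'I_n -> A) (q : 'I_n -> {fraction R}) :
  lin_indep e -> \sum_i q i *: tensor (e i) 1 = 0 -> forall i, q i = 0.
Proof.
move=> ie q0; have [d d0 [r er]] := common_denominator q.
have : tensor (\sum_i r i *: e i) 1 = 0.
  rewrite tensor_sum; transitivity (tofrac d *: \sum_i q i *: tensor (e i) 1).
    rewrite scaler_sumr; apply: eq_bigr => i _.
    by rewrite scalerA er.
  by rewrite q0 scaler0.
move=> /tensor1_eq0[d' d'0]; rewrite scaler_sumr.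
under eq_bigr do rewrite scalerA.
move=> /ie r0 i; have /eqP := r0 i; rewrite mulf_eq0 (negPf d'0) /= => /eqP ri.
apply/eqP; have /eqP := er i; rewrite ri rmorph0 mulf_eq0 tofrac_eq0.
by rewrite (negPf d0).
Qed.

End Independence.

(** A left kernel vector of the matrix of coordinates of [e] in [f] is a relation among the [e i],
    so the rows are independent and cannot outnumber the columns. *)
Lemma indep_le_span (K : fieldType) (V : lmodType K) m n
    (e : 'I_m -> V) (f : 'I_n -> V) :
  (forall v, exists c : 'I_n -> K, v = \sum_i c i *: f i) ->
  (forall c : 'I_m -> K, \sum_i c i *: e i = 0 -> forall i, c i = 0) ->
  (m <= n)%N.
Proof.
move=> sf ie; have /choice[c ec] i := sf (e i).
pose M := \matrix_(i, j) c i j; suff /eqP <- : row_free M by exact: rank_leq_col.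
rewrite -kermx_eq0; apply/eqP/row_matrixP => k; rewrite row0; apply/rowP => i.
have : row k (kermx M) *m M = 0 by apply/sub_kermxP; rewrite row_sub.
set u := row k _ => /rowP uM; rewrite [RHS]mxE; apply: (ie (fun i => u 0 i)).
under eq_bigr do rewrite ec scaler_sumr.
rewrite exchange_big big1 //= => j _; under eq_bigr do rewrite scalerA.
rewrite -scaler_suml -[RHS](scale0r (f j)); congr (_ *: _).
have := uM j; rewrite [RHS]mxE; apply: etrans; rewrite mxE.
by apply: eq_bigr => i' _; rewrite [M _ _]mxE.
Qed.

(** Since [vdim] chooses among the sizes of bases, computing it amounts to the invariance of that
    size. *)
Lemma vdim_basis (K : fieldType) (V : lmodType K) n (e : 'I_n -> V) :
  is_basis e -> vdim V = n.
Proof.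
have sp k (f : 'I_k -> V) : is_basis f ->
    forall v, exists c : 'I_k -> K, v = \sum_i c i *: f i.
  by move=> bf v; have [c [ec _]] := bf v; exists c.
have ind k (f : 'I_k -> V) : is_basis f ->
    forall c : 'I_k -> K, \sum_i c i *: f i = 0 -> forall i, c i = 0.
  move=> bf c c0 i; have [c' [_ uc']] := bf 0.
  suff : finfun c i = 0 by rewrite ffunE.
  have <- : c' = finfun c.
    by apply: uc'; rewrite -[LHS]c0; apply: eq_bigr => j _; rewrite ffunE.
  by rewrite (uc' [ffun=> 0]) ?ffunE // big1 // => j _; rewrite ffunE scale0r.
move=> be; apply: xget_unique; first by exists e.
move=> k [f bf]; apply/eqP; rewrite eqn_leq.
by apply/andP; split; apply: indep_le_span; do [exact: sp|exact: ind].
Qed.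

(** * Rank through maximal independent families *)

Section Rank.
Context (R : idomainType).
Implicit Types A : lmodType R.

Lemma rank_max_indep A n (e : 'I_n -> A) : max_indep e -> rank A = n.
Proof.
move=> [ie me]; apply: (@vdim_basis _ _ _ (fun i => tensor (e i) 1)) => v.
have [d d0 [a ea]] := tensorQ_frac v; have [d' d'0 [c ec]] := me a.
have D0 : tofrac (d' * d) != 0 by rewrite tofrac_eq0 mulf_neq0.
have vE : v = \sum_i (tofrac (d' * d))^-1 * tofrac (c i) *: tensor (e i) 1.
  under eq_bigr do rewrite -scalerA.
  rewrite -scaler_sumr -tensor_sum -ec tensorZl -tensorZ -ea.
  rewrite [X in _ *: X]scalerA -rmorphM.
  by rewrite scalerA mulVf // scale1r.
exists [ffun i => (tofrac (d' * d))^-1 * tofrac (c i)]; split.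
  by rewrite [LHS]vE; apply: eq_bigr => i _; rewrite ffunE.
move=> c' ec'; apply/ffunP => i; rewrite ffunE; apply/eqP; rewrite -subr_eq0.
apply/eqP/(lin_indep_tensor (q := fun i => _ - c' i) ie).
by under eq_bigr do rewrite scalerBl; rewrite sumrB -vE -ec' subrr.
Qed.

(** A longest independent family exists because comparison after tensoring bounds its size by the
    number of generators. *)
Lemma fg_max_indep A : finitely_generated A ->
  exists n (e : 'I_n -> A), max_indep e.
Proof.
move=> [N [g sg]].
pose P m := `[< exists e : 'I_m -> A, lin_indep e >].
have P0 : exists m, P m.
  by exists 0%N; apply/asboolP; exists (fun=> 0) => c _ [].
have Pub m : P m -> (m <= N)%N.
  move=> /asboolP[e ie]; apply: (@indep_le_span _ _ _ _
    (fun i => tensor (e i) 1) (fun i => tensor (g i) 1)); last first.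
    by move=> c; exact: lin_indep_tensor.
  move=> v; have [d d0 [a ea]] := tensorQ_frac v; have [c ec] := sg a.
  exists (fun i => (tofrac d)^-1 * tofrac (c i)).
  under eq_bigr do rewrite -scalerA.
  by rewrite -scaler_sumr -tensor_sum -ec -ea scalerA mulVf ?scale1r ?tofrac_eq0.
case: (ex_maxnP P0 Pub) => m /asboolP[e ie] maxm; exists m, e; split => // a.
(* With [a] put in front, [e] is too long to stay independent; a nontrivial relation must involve
   [a], otherwise it would be one among the [e j]. *)
pose e' (i : 'I_m.+1) := if unlift ord0 i is Some j then e j else a.
suff [c0] : exists2 c : 'I_m.+1 -> R, \sum_i c i *: e' i = 0 & c ord0 != 0.
  rewrite big_ord_recl /e' unlift_none => /eqP; rewrite addr_eq0 => /eqP cE cn.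
  exists (c0 ord0) => //; exists (fun i => - c0 (fintype.lift ord0 i)).
  by rewrite cE -sumrN; apply: eq_bigr => i _; rewrite liftK scaleNr.
apply: contrapT => nc; have /maxm : P m.+1; last by rewrite ltnn.
apply/asboolP; exists e' => c c0.
have z0 : c ord0 = 0 by apply/eqP/negPn/negP => c00; apply: nc; exists c.
move: c0; rewrite big_ord_recl z0 scale0r add0r /e'.
under eq_bigr do rewrite liftK.
move=> /ie c0 i; case: (unliftP ord0 i) => [j ->|-> //]; exact: c0.
Qed.

(** The family joins [e] with lifts [b] of [e'] along [g]. Applying [g] to a relation isolates the
    coefficients of the lifts. *)
Lemma max_indep_exact (A B C : lmodType R) n m
    (f : {linear A -> B}) (g : {linear B -> C})
    (e : 'I_n -> submod (im_pred f)) (e' : 'I_m -> submod (im_pred g)) :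
  (forall b, g b = 0 <-> exists a, f a = b) -> max_indep e -> max_indep e' ->
  exists u : 'I_(n + m) -> B, max_indep u.
Proof.
move=> ex [ie me] [ie' me'].
have /choice[b eb] j : exists b, g b = val (e' j).
  by have /asboolP := submodP (e' j).
have ge i : g (val (e i)) = 0 by apply/ex; have /asboolP := submodP (e i).
pose u i := match fintype.split i with inl j => val (e j) | inr j => b j end.
have ul i : u (lshift m i) = val (e i) by rewrite /u (unsplitK (inl i)).
have ur i : u (rshift n i) = b i by rewrite /u (unsplitK (inr i)).
have gsum (c : 'I_m -> R) : g (\sum_i c i *: b i) = val (\sum_i c i *: e' i).
  by rewrite !linear_sum; apply: eq_bigr => i _; rewrite !linearZ /= eb.
have esum (c : 'I_n -> R) : \sum_i c i *: val (e i) = val (\sum_i c i *: e i).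
  by rewrite linear_sum; apply: eq_bigr => i _; rewrite linearZ.
exists u; split=> [c|x].
  rewrite big_split_ord /=; under eq_bigr do rewrite ul.
  under [in X in _ + X]eq_bigr do rewrite ur.
  rewrite (esum (fun i => c (lshift m i))) => c0.
  have : g (\sum_(i < m) c (rshift n i) *: b i) = 0.
    have := congr1 g c0; rewrite linearD linear0 -esum linear_sum big1 ?add0r //.
    by move=> i _; rewrite linearZ /= ge scaler0.
  rewrite (gsum (fun i => c (rshift n i))) => /(@val_inj _ _ _ _ 0)/ie' cr.
  move: c0; rewrite [in X in _ + X]big1 ?addr0 => [/(@val_inj _ _ _ _ 0)/ie cl|].
    by move=> i; case: (split_ordP i) => j ->; [exact: cl|exact: cr].
  by move=> i _; rewrite cr scale0r.
have gx : g x \in im_pred g by apply/asboolP; exists x.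
(* Up to the kernel of [g], hence up to the image of [f], [d *: x] is a combination of lifts; the
   factor [d'] then brings the difference into the span of [e]. *)
have [d d0 [c' /(congr1 val)]] := me' (Submod gx).
rewrite -gsum linearZ /= -linearZ => /eqP; rewrite -subr_eq0 -linearB => /eqP.
move=> /ex[a fa]; have /asboolP ya := ex_intro (fun a' => f a' = _) a fa.
have [d' d'0 [c /(congr1 val)]] := me (Submod (ya : _ \in im_pred f)).
rewrite -esum linearZ /= => cE; exists (d' * d); first by rewrite mulf_neq0.
exists (fun i => match fintype.split i with inl j => c j | inr j => d' * c' j end).
rewrite big_split_ord /=; under eq_bigr do rewrite ul (unsplitK (inl _)).
under [in X in _ + X]eq_bigr do rewrite ur (unsplitK (inr _)) -scalerA.
by rewrite -cE -scaler_sumr -scalerDr subrK scalerA.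
Qed.

Lemma fg_im (A B : lmodType R) (f : {linear A -> B}) :
  finitely_generated A -> finitely_generated (submod (im_pred f)).
Proof.
move=> [n [e sp]]; have fe i : f (e i) \in im_pred f by apply/asboolP; exists (e i).
exists n, (fun i => Submod (fe i)) => y; have /asboolP[x fx] := submodP y.
have [c ec] := sp x; exists c; apply: val_inj.
by rewrite linear_sum /= -fx ec linear_sum; apply: eq_bigr => i _; rewrite !linearZ.
Qed.

Lemma rank_exact (A B C : lmodType R) (f : {linear A -> B}) (g : {linear B -> C}) :
  finitely_generated A -> finitely_generated B ->
  (forall b, g b = 0 <-> exists a, f a = b) ->
  rank B = (rank (submod (im_pred f)) + rank (submod (im_pred g)))%N.
Proof.
move=> /(fg_im f)/fg_max_indep[n [e me]] /(fg_im g)/fg_max_indep[m [e' me']] ex.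
have [u mu] := max_indep_exact ex me me'.
by rewrite (rank_max_indep me) (rank_max_indep me') (rank_max_indep mu).
Qed.

Lemma rank_trivial A : (forall a : A, a = 0) -> rank A = 0%N.
Proof.
move=> A0; apply: (@rank_max_indep _ _ (fun=> 0)); split=> [c _ []//|a].
by exists 1; [exact: oner_neq0|exists (fun=> 0); rewrite [LHS]A0 big_ord0].
Qed.

End Rank.

(** * Induced maps on homology *)

Section HomologyMap.
Context (R : pzRingType).

Lemma homology_class_eq0 (C : chain_complex R) n (z : cycles C n) :
  homology_class z = 0 <-> z \in boundary_pred C n.
Proof.
have h0 : homology_class (0 : cycles C n) = 0 := linear0 (quotmod_proj _).
by have := quotmod_projP (boundary_pred C n) z 0; rewrite subr0 -h0.
Qed.

(** The separate degree [m] avoids a cast when the cycle has degree [n - 1] and the chain bounding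
    it has degree [n]. *)
Lemma boundary_diffP (C : chain_complex R) m n (z : cycles C n) : m = n + 1 ->
  z \in boundary_pred C n -> exists x : C m, diff C m n x = val z.
Proof. by move=> -> /asboolP. Qed.

Context (A B : chain_complex R) (f : chain_map A B) (n : int).

Lemma chain_map_cycle (z : cycles A n) :
  f n (val z) \in ker_pred (diff B n (n - 1)).
Proof.
have /eqP dz := submodP z.
by rewrite unfold_in -chain_comm dz linear0.
Qed.

Definition cycle_map z : cycles B n := Submod (chain_map_cycle z).

Lemma cycle_mapP a z z' : cycle_map (a *: z + z') = a *: cycle_map z + cycle_map z'.
Proof. by apply: val_inj; rewrite /= !linearP. Qed.

Lemma cycle_map_boundary z :
  z \in boundary_pred A n -> cycle_map z \in boundary_pred B n.
Proof.
move=> /asboolP[x dx]; apply: (@boundary_diff _ _ _ _ (f _ x)).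
by rewrite -chain_comm dx.
Qed.

Definition homology_map_fun (h : homology A n) : homology B n :=
  homology_class (cycle_map (repr h)).

Lemma homology_map_funE z :
  homology_map_fun (homology_class z) = homology_class (cycle_map z).
Proof.
apply/quotmod_projP; set z' := repr _.
have -> : cycle_map z' - cycle_map z = cycle_map (z' - z).
  by have := cycle_mapP (-1) z z'; rewrite !scaleN1r ![- _ + _]addrC.
by apply/cycle_map_boundary/quotmod_projP; rewrite /quotmod_proj reprK.
Qed.

Lemma homology_map_is_linear : linear homology_map_fun.
Proof.
move=> a h h'; have [z <-] := quotmod_surj h; have [z' <-] := quotmod_surj h'.
rewrite -[LHS]/(homology_map_fun (a *: homology_class z + homology_class z')).
by rewrite !homology_map_funE -!linearP homology_map_funE cycle_mapP.
Qed.

HB.instance Definition _ := GRing.isLinear.Build R (homology A n)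
  (homology B n) _ homology_map_fun homology_map_is_linear.

Definition homology_map : {linear homology A n -> homology B n} :=
  homology_map_fun.

Lemma homology_mapE z :
  homology_map (homology_class z) = homology_class (cycle_map z).
Proof. exact: homology_map_funE. Qed.

End HomologyMap.

(** * The long exact homology sequence *)

Section LongExactSequence.
Context (R : pzRingType) (A B C : chain_complex R) (S : short_exact A B C).
Context (n : int).
Local Notation f := (ses_in S).
Local Notation g := (ses_out S).

Let gf0 m a : g m (f m a) = 0.
Proof. by apply/(ses_exact S); exists a. Qed.

Lemma connectingE z y : connecting_rel S z y ->
  connecting S n (homology_class z) = homology_class y.
Proof. exact: connecting_funE. Qed.

Lemma homology_exact_mid y :
  homology_map g n y = 0 <-> exists x, homology_map f n x = y.
Proof.
have [z <-] := quotmod_surj y; split.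
  rewrite [homology_map _ _ _]homology_mapE homology_class_eq0.
  (* Subtracting the boundary of a lift [b] of [c] keeps the class of [z] and moves the cycle into
     the image of [f]. *)
  move=> /asboolP[c /= dc]; have [b gb] := ses_surj S c.
  have /(ses_exact S)[a fa] : g n (val z - diff B (n + 1) n b) = 0.
    by rewrite linearB chain_comm gb dc subrr.
  have aK : a \in ker_pred (diff A n (n - 1)).
    have /eqP dz := submodP z.
    rewrite unfold_in; apply/eqP; apply: (@ses_inj _ _ _ _ S).
    by rewrite chain_comm fa linearB diff_diff dz subr0 linear0.
  exists (homology_class (Submod aK)); rewrite homology_mapE.
  apply/quotmod_projP/(@boundary_diff _ _ _ _ (- b)).
  by rewrite linearB linearN /= fa addrAC subrr sub0r.
move=> [x <-]; have [w <-] := quotmod_surj x.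
rewrite [homology_map _ _ (quotmod_proj _ _)]homology_mapE homology_mapE.
apply/homology_class_eq0/(@boundary_diff _ _ _ n 0).
by rewrite linear0 /= gf0.
Qed.

Lemma homology_exact_right y :
  connecting S n y = 0 <-> exists x, homology_map g n x = y.
Proof.
have [z <-] := quotmod_surj y; split.
  have [w zw] := connecting_rel_ex S z; have [b [gb fw]] := zw.
  rewrite [connecting _ _ _](connectingE zw) homology_class_eq0.
  move=> /(boundary_diffP (esym (subrK 1 n)))[a da].
  (* As [w] is the boundary of [a], subtracting [f n a] turns the lift [b] of [z] into a cycle with
     the same image in [C]. *)
  have bK : b - f n a \in ker_pred (diff B n (n - 1)).
    by rewrite unfold_in linearB -chain_comm da fw subrr.
  exists (homology_class (Submod bK)); rewrite homology_mapE.
  congr homology_class; apply: val_inj.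
  by rewrite /= linearB gf0 subr0.
move=> [x <-]; have [b <-] := quotmod_surj x.
rewrite [homology_map _ _ _]homology_mapE (@connectingE _ 0).
  exact: (linear0 (quotmod_proj _)).
(* A cycle of [B] lifts its own image and has zero boundary, so it witnesses the value [0]. *)
have /eqP db := submodP b.
by exists (val b); rewrite db !linear0.
Qed.

Lemma homology_exact_left y :
  homology_map f (n - 1) y = 0 <-> exists x, connecting S n x = y.
Proof.
have [w <-] := quotmod_surj y; split.
  rewrite [homology_map _ _ _]homology_mapE homology_class_eq0.
  move=> /(boundary_diffP (esym (subrK 1 n)))[b /= db].
  (* The chain [b], whose boundary is the image of [w], exhibits [w] as the connecting image of the
     class of [g n b]. *)
  have zK : g n b \in ker_pred (diff C n (n - 1)).
    by rewrite unfold_in -chain_comm db gf0.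
  exists (homology_class (Submod zK)); apply: connectingE.
  by exists b.
move=> [x <-]; have [z <-] := quotmod_surj x.
have [w' zw'] := connecting_rel_ex S z; have [b [gb fw]] := zw'.
rewrite [connecting _ _ _](connectingE zw') homology_mapE.
by apply/homology_class_eq0/(@boundary_diff _ _ _ n b); rewrite /= fw.
Qed.

End LongExactSequence.

(** * Limits of iterated Cesaro means *)

Section Holder.
Context (K : realType).
Implicit Types (a b : K ^nat) (l m : K).

Lemma cesaro_mulE a n : cesaro_mul a n = n.+1%:R^-1 * \sum_(j < n.+1) a j.
Proof.
rewrite mulr_sumr; apply: eq_bigr => j _.
by rewrite /cesaro_coef -ltnS ltn_ord.
Qed.

Lemma cvg_cesaro_mul a l : a @ \oo --> l -> cesaro_mul a @ \oo --> l.
Proof.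
move=> /cesaro; suff -> : cesaro_mul a = arithmetic_mean a by [].
by apply/funext => n; rewrite cesaro_mulE /arithmetic_mean /= seriesEord.
Qed.

Lemma iter_cesaro_mulB k a b :
  iter k cesaro_mul (a - b) = iter k cesaro_mul a - iter k cesaro_mul b.
Proof.
elim: k => //= k ->; apply/funext => n.
rewrite -[RHS]/(cesaro_mul (iter k cesaro_mul a) n -
  cesaro_mul (iter k cesaro_mul b) n) !cesaro_mulE -mulrBr -sumrB.
by congr (_ * _); apply: eq_bigr.
Qed.

(** This is the relation from which [Hlim] chooses; unlike [Hlim], which defaults to [0], it records
    convergence and so passes to differences. *)
Definition Hconverges_to a l : Prop :=
  \forall k \near \oo, iter k cesaro_mul a @ \oo --> l.

Lemma Hconverges_to_unique a l m :
  Hconverges_to a l -> Hconverges_to a m -> l = m.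
Proof.
move=> al am; have [k [kl km]] := filter_ex (filterI al am).
exact: (cvg_unique _ kl km).
Qed.

(** One convergent iterate suffices, since Cesaro means preserve limits and so every later iterate
    has the same one. *)
Lemma Hconverges_to_Hlim a : Hconvergent a -> Hconverges_to a (Hlim a).
Proof.
move=> [k _ /cvg_ex[l al]]; suff h : Hconverges_to a l by apply: xgetPex; exists l.
exists k => // i /= /subnK <-; elim: (i - k)%N => //= j; exact: cvg_cesaro_mul.
Qed.

Lemma Hconverges_toB a b l m :
  Hconverges_to a l -> Hconverges_to b m -> Hconverges_to (a - b) (l - m).
Proof.
move=> al bm; near=> k; rewrite iter_cesaro_mulB; apply: cvgB.
  by near: k.
by near: k.
Unshelve. all: by end_near.
Qed.

(** The iterates of [cesaro_mul a] are those of [a] shifted by one. *)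
Lemma Hconverges_to_cesaro_mul a l :
  Hconverges_to a l -> Hconverges_to (cesaro_mul a) l.
Proof.
move=> [k _ ak]; exists k => // i /= ki; rewrite -iterSr; apply: ak.
exact: leq_trans ki _.
Qed.

End Holder.

(** * Counting ranks along the long exact sequence, and the conclusion *)

Lemma rank_homology_alternating (R : idomainType) (A B C : chain_complex R)
    (S : short_exact A B C) (n : nat) :
  let r (k : nat) := rank (submod (im_pred (connecting S k%:Z))) in
  (forall k, finitely_generated (homology A k)) ->
  (forall k, finitely_generated (homology B k)) ->
  (forall k, finitely_generated (homology C k)) ->
  (rank (homology A n) + rank (homology C n) =
   rank (homology B n) + r n + r n.+1)%N.
Proof.
move=> r fgA fgB fgC.
have Ea : rank (homology A n) =
    (r n.+1 + rank (submod (im_pred (homology_map (ses_in S) n))))%N.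
  have := rank_exact (fgC n.+1) (fgA _) (@homology_exact_left _ _ _ _ S n.+1).
  by rewrite -/(r n.+1) (_ : n.+1%:Z - 1 = n) // -addn1 PoszD addrK.
(* The ranks of the images of the two induced maps now occur on both sides and cancel. *)
rewrite Ea (rank_exact (fgA n) (fgB n) (@homology_exact_mid _ _ _ _ S n)).
rewrite (rank_exact (fgB n) (fgC n) (@homology_exact_right _ _ _ _ S n)).
by rewrite -/(r n) -addnA addnC !addnA.
Qed.

Theorem theorem4p3 (K : realType) (R : idomainType) (noethR : noetherian R)
    (A B C : chain_complex R) (S : short_exact A B C)
    (preA : pre_admissible K A) (preB : pre_admissible K B)
    (preC : pre_admissible K C) (wS : weakly_admissible K S) :
  Euler_char K A - Euler_char K B + Euler_char K C = 0.
Proof.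
have [A0 fgA cA] := preA; have [_ fgB cB] := preB; have [_ fgC cC] := preC.
have [cw w0] := wS.
rewrite (_ : _ + _ = Euler_char K A - (Euler_char K B - Euler_char K C)); last first.
  by rewrite opprB addrA [RHS]addrAC.
have h := Hconverges_toB (Hconverges_to_Hlim cA)
  (Hconverges_toB (Hconverges_to_Hlim cB) (Hconverges_to_Hlim cC)).
apply: (Hconverges_to_unique (Hconverges_to_cesaro_mul h)); rewrite -w0.
set w := (X in Hlim X); suff -> : cesaro_mul (homology_rank_seq K A -
    (homology_rank_seq K B - homology_rank_seq K C)) = w.
  exact: Hconverges_to_Hlim.
pose r (k : nat) := rank (submod (im_pred (connecting S k%:Z))).
(* The connecting map in degree [0] lands in the homology of [A] in degree [-1], where [A]
   vanishes. *)
have r0 : r 0%N = 0%N.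
  apply: rank_trivial => y; apply: val_inj => /=; have [z <-] := quotmod_surj (val y).
  suff -> : z = 0 by exact: (linear0 (quotmod_proj _)).
  by apply: val_inj; exact: A0.
apply/funext => n; rewrite cesaro_mulE /w -mulrA; congr (_ * _).
have uE k : (homology_rank_seq K A - (homology_rank_seq K B -
    homology_rank_seq K C)) k = (-1) ^+ k * (r k + r k.+1)%:R.
  have /(congr1 (fun m => m%:R : K)) := rank_homology_alternating S k fgA fgB fgC.
  rewrite -/(r k) -/(r k.+1) -addnA /= !natrD => E.
  rewrite -[LHS]/(_ * _ - (_ * _ - _ * _)) opprB addrA -mulrDr E mulrDr.
  by rewrite addrAC subrr add0r -natrD.
(* The sum up to [n] is [(-1) ^+ n * (r n.+1)%:R]: it starts from [r0], and each new term cancels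
   the previous value. *)
elim: n => [|n IH]; first by rewrite big_ord1 uE r0.
by rewrite big_ord_recr /= IH uE exprS mulN1r natrD mulrDr !mulNr addrA subrr add0r.
Qed.
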